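(* If $\mathfrak{t} = \min\{\operatorname{cf}(\mathfrak{c}), \mathfrak{r}\}$, then $cov(v^0) = add(v^0)$.
   Context: $[\omega]^\omega$ is the family of all infinite subsets of $\omega$. For $A \subseteq B \subseteq \omega$ with $B\setminus A$ infinite, the set $\langle A,B\rangle = \{X \in [\omega]^\omega : A \subseteq X \subseteq B\}$ is called a segment. A set $S \subseteq [\omega]^\omega$ is a $v^0$-set if for each segment $\langle A,B\rangle$ there is a segment $\langle C,D\rangle \subseteq \langle A,B\rangle$ with $\langle C,D\rangle \cap S = \emptyset$. The family of all $v^0$-sets is a $\sigma$-ideal, denoted $(v^0)$. $add(v^0) = \min\{|\mathcal{F}| : \mathcal{F} \subseteq (v^0) \text{ and } \bigcup\mathcal{F} \notin (v^0)\}$ and $cov(v^0) = \min\{|\mathcal{F}| : \mathcal{F} \subseteq (v^0) \text{ and } \bigcup\mathcal{F} = [\omega]^\omega\}$. $\mathfrak{c}$ is the cardinality of the continuum and $\operatorname{cf}(\mathfrak{c})$ its cofinality. $A \subseteq^* X$ means that $A \setminus X$ is finite. The tower number $\mathfrak{t}$ is the least length of a $\subseteq^*$-decreasing transfinite sequence in $[\omega]^\omega$ with no infinite set $\subseteq^*$-below all its members. The reaping number $\mathfrak{r}$ is the least cardinality of a family $\mathcal{R} \subseteq [\omega]^\omega$ such that there is no $X \subseteq \omega$ with both $R\cap X$ and $R \setminus X$ infinite for all $R \in \mathcal{R}$. *)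

(* Defs.v *)
From mathcomp Require Import all_boot.
From mathcomp Require Import all_classical wochoice.

Set Implicit Arguments.
Unset Strict Implicit.
Unset Printing Implicit Defensive.

Local Open Scope classical_set_scope.
Local Open Scope card_scope.

(* An ordinal is represented by a well-ordered type, a cardinal by the initial
   ordinal of its size; equality of ordinals is the isomorphism [ord_eq].
   The field [wo_le] is the reflexive order: [well_order] says that every
   nonempty subset has a unique least element, which makes it a total order. *)
Record wellOrder := WellOrder {
  wo_sort :> Type;
  wo_le : rel wo_sort;
  wo_leP : well_order wo_le }.

Arguments wo_le {w} x y.

Definition wo_lt (W : wellOrder) (x y : W) : Prop := wo_le x y /\ x <> y.

Definition wo_embedding (V W : wellOrder) (f : V -> W) : Prop :=
  forall x y, wo_le (f x) (f y) = wo_le x y.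

(* V is isomorphic to an initial segment of W. *)
Definition ord_le (V W : wellOrder) : Prop :=
  exists f : V -> W, wo_embedding f /\
    forall (x : V) (y : W), wo_le y (f x) -> exists x', f x' = y.

Definition ord_eq (V W : wellOrder) : Prop :=
  exists f : V -> W, wo_embedding f /\ bijective f.

Lemma void_well_order : well_order (fun _ _ : void => true).
Proof. by move=> A [[]]. Qed.

Definition ord0 : wellOrder := WellOrder void_well_order.

Definition is_least_ord (P : wellOrder -> Prop) (W : wellOrder) : Prop :=
  P W /\ forall V, P V -> ord_le W V.

(* The least ordinal in the class P (0 if P is empty). Classes of ordinals are
   bare predicates: with [set wellOrder] the types [set X] could no longer be
   carriers of well-orders, as the universe of [set] is not polymorphic. *)
Definition least_ord (P : wellOrder -> Prop) : wellOrder :=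
  match pselect (exists W, is_least_ord P W) with
  | left exW => projT1 (cid exW)
  | right _ => ord0
  end.

Definition ord_min (V W : wellOrder) : wellOrder :=
  least_ord (fun U => U = V \/ U = W).

Definition cardinal_of (T : Type) (A : set T) : wellOrder :=
  least_ord (fun W => [set: W] #= A).

Definition cofinal (W : wellOrder) (D : set W) : Prop :=
  forall x, exists2 y, D y & wo_le x y.

Definition cofinality (W : wellOrder) : wellOrder :=
  least_ord (fun K => exists2 D : set W, cofinal D & K = cardinal_of D).

Definition continuum : wellOrder := cardinal_of [set: set nat].

Definition infinite_sets : set (set nat) := [set X | infinite_set X].

Definition almost_subset (A X : set nat) : Prop := finite_set (A `\` X).

Definition is_tower (W : wellOrder) (T : W -> set nat) : Prop :=
  [/\ forall x, infinite_sets (T x),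
      forall x y, wo_lt x y -> almost_subset (T y) (T x) &
      ~ exists2 P, infinite_sets P & forall x, almost_subset P (T x)].

Definition tower_number : wellOrder :=
  least_ord (fun W => exists T : W -> set nat, is_tower T).

Definition splits (X R : set nat) : Prop :=
  infinite_set (R `&` X) /\ infinite_set (R `\` X).

Definition is_reaping (RR : set (set nat)) : Prop :=
  RR `<=` infinite_sets /\ ~ exists X, forall R, RR R -> splits X R.

Definition reaping_number : wellOrder :=
  least_ord (fun K => exists2 RR, is_reaping RR & K = cardinal_of RR).

(* The condition on A and B under which [segment A B] is a segment. *)
Definition segment_ends (A B : set nat) : Prop :=
  A `<=` B /\ infinite_set (B `\` A).

Definition segment (A B : set nat) : set (set nat) :=
  [set X | infinite_sets X /\ A `<=` X /\ X `<=` B].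

Definition v0 : set (set (set nat)) :=
  [set S | S `<=` infinite_sets /\
    forall A B, segment_ends A B ->
      exists C D, [/\ segment_ends C D, segment C D `<=` segment A B &
                      segment C D `&` S = set0]].

Definition add_v0 : wellOrder :=
  least_ord (fun K => exists F : set (set (set nat)),
    [/\ F `<=` v0, ~ v0 (\bigcup_(S in F) S) & K = cardinal_of F]).

Definition cov_v0 : wellOrder :=
  least_ord (fun K => exists F : set (set (set nat)),
    [/\ F `<=` v0, \bigcup_(S in F) S = infinite_sets & K = cardinal_of F]).

(* Main.v *)
Require Import Defs.
From mathcomp Require Import all_boot zify.
From mathcomp Require Import all_classical wochoice.

(** Always add(v^0) <= cov(v^0), and cov(v^0) <= min(cf(c), r): sets of size
    less than c are v^0, and so is the set of all X for which
    {n : |X ∩ n| is odd} does not split a given infinite R. Hence the hypothesis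
    gives cov(v^0) <= t. If the union of a family of size kappa < cov(v^0) of
    v^0-sets were not v^0, a base matrix argument would give a contradiction:
    there are kappa many rows, refining each other, of conditions with disjoint
    cubes, the alpha-th avoiding the alpha-th set. As kappa < cov(v^0), some X
    lies in a cube of every row; the conditions it selects are decreasing and X
    uniformizes them, so that kappa < t yields a condition below all of them. *)

Set Implicit Arguments.
Unset Strict Implicit.
Unset Printing Implicit Defensive.

Local Open Scope classical_set_scope.
Local Open Scope card_scope.

(** * Ordinals *)

Lemma wo_ex_min (W : wellOrder) (Q : W -> Prop) :
  (exists x, Q x) -> exists2 z, Q z & forall y, Q y -> wo_le z y.
Proof.
case=> x Qx; have [|z [[Qz zmin] _]] := @wo_leP W (fun y => `[< Q y >]).
  by exists x; apply/asboolP.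
by exists z => [|y Qy]; [exact/asboolP | apply: zmin; exact/asboolP].
Qed.

Lemma wo_le_total (W : wellOrder) (x y : W) : wo_le x y \/ wo_le y x.
Proof.
have [|z [->|->] zmin] := @wo_ex_min W (fun z => z = x \/ z = y).
- by exists x; left.
- by left; apply: zmin; right.
- by right; apply: zmin; left.
Qed.

Lemma wo_le_refl (W : wellOrder) (x : W) : wo_le x x.
Proof. by case: (wo_le_total x x). Qed.

Lemma wo_le_anti (W : wellOrder) (x y : W) : wo_le x y -> wo_le y x -> x = y.
Proof.
move=> xy yx; pose Q z := `[< z = x \/ z = y >].
have [|z [_ zU]] := @wo_leP W Q; first by exists x; apply/asboolP; left.
rewrite -(zU x) ?(zU y) //; split; try by apply/asboolP; tauto.
- by move=> u /asboolP[->|->] //; exact: wo_le_refl.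
- by move=> u /asboolP[->|->] //; exact: wo_le_refl.
Qed.

Lemma wo_leNlt (W : wellOrder) (x y : W) : wo_le x y <-> ~ wo_lt y x.
Proof.
split=> [xy [yx]|]; first by apply; exact: wo_le_anti.
move=> nyx; have [//|yx] := wo_le_total x y.
have [->|xny] := pselect (y = x); first exact: wo_le_refl.
by case: nyx.
Qed.

Lemma wo_lt_trans (W : wellOrder) (x y z : W) :
  wo_lt x y -> wo_lt y z -> wo_lt x z.
Proof.
move=> [xy xNy] [yz yNz].
have [|m mE mmin] := @wo_ex_min W (fun u => [\/ u = x, u = y | u = z]).
  by exists x; apply: Or31.
have mx : wo_le m x by apply: mmin; apply: Or31.
have my : wo_le m y by apply: mmin; apply: Or32.
have mz : wo_le m z by apply: mmin; apply: Or33.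
case: mE mx my mz => ->.
- move=> _ _ xz; split=> // xEz; subst z; exact/xNy/wo_le_anti.
- by move=> yx; case: xNy; exact: wo_le_anti.
- by move=> _ zy; case: yNz; exact: wo_le_anti.
Qed.

Lemma wo_ltxx (W : wellOrder) (x : W) : ~ wo_lt x x.
Proof. by case. Qed.

Lemma wo_lt_total (W : wellOrder) (x y : W) : [\/ wo_lt x y, x = y | wo_lt y x].
Proof.
have [->|xy] := pselect (x = y); first exact: Or32.
have [xy'|yx] := wo_le_total x y; first exact: Or31.
by apply: Or33; split=> // /esym.
Qed.

Lemma wo_ind (W : wellOrder) (Q : W -> Prop) :
  (forall x, (forall y, wo_lt y x -> Q y) -> Q x) -> forall x, Q x.
Proof.
move=> IH x; apply: contrapT => nQx.
have [|z nQz zmin] := @wo_ex_min W (fun x => ~ Q x); first by exists x.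
apply/nQz/IH => y [yz yNz]; apply: contrapT => /zmin zy.
exact/yNz/wo_le_anti.
Qed.

(** Transfinite recursion for a specification [R] that depends only on earlier values: at each stage
    some admissible value is chosen, and induction shows that one always exists. *)
Lemma wo_choice (W : wellOrder) (T : Type) (t0 : T)
    (R : W -> (W -> T) -> T -> Prop) :
  (forall w f g t, (forall u, wo_lt u w -> f u = g u) -> R w f t -> R w g t) ->
  (forall w f, (forall u, wo_lt u w -> R u f (f u)) -> exists t, R w f t) ->
  exists f, forall w, R w f (f w).
Proof.
move=> Rext Rex.
have wf : well_founded (@wo_lt W).
  by apply: wo_ind => x IH; constructor.
(* The history is padded with [t0] from [w] on; by the first hypothesis on [R] the padding is
   invisible. *)
pose hist (w : W) (h : forall u, wo_lt u w -> T) u :=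
  if pselect (wo_lt u w) is left uw then h u uw else t0.
pose step (w : W) (h : forall u, wo_lt u w -> T) :=
  if pselect (exists t, R w (hist w h) t) is left e then projT1 (cid e) else t0.
pose f := Fix wf (fun=> T) step.
have fE w : f w = step w (fun u _ => f u).
  rewrite /f Fix_eq // => x g h gh; congr step.
  by apply: functional_extensionality_dep => u;
     apply: functional_extensionality_dep => ux; apply: gh.
exists f; apply: wo_ind => w IH.
have histE u : wo_lt u w -> hist w (fun u _ => f u) u = f u.
  by rewrite /hist; case: pselect.
rewrite fE /step; case: pselect => [e|[]]; last first.
  have [t Rt] := Rex w f IH; exists t; apply: Rext Rt => u uw.
  by rewrite histE.
by case: cid => /= t Rt; apply: Rext Rt => u uw; rewrite histE.
Qed.

(** * Comparison of well-orders *)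

Definition wo_mono (V W : wellOrder) (f : V -> W) : Prop :=
  forall x y, wo_lt x y -> wo_lt (f x) (f y).

Lemma wo_mono_embedding (V W : wellOrder) (f : V -> W) :
  wo_mono f -> wo_embedding f.
Proof.
move=> fm x y; apply/idP/idP => [|xy].
  move=> fxy; apply/wo_leNlt => yx; move/wo_leNlt: fxy; apply; exact: fm.
have [->|xNy] := pselect (x = y); first exact: wo_le_refl.
by have [] := fm x y.
Qed.

Lemma wo_embedding_mono (V W : wellOrder) (f : V -> W) :
  wo_embedding f -> wo_mono f.
Proof.
move=> fe x y [xy xNy]; split; first by rewrite fe.
move=> fxy; apply/xNy/wo_le_anti => //.
by rewrite -fe fxy wo_le_refl.
Qed.

(** If [f x] were below [x], then [f (f x)] would be below [f x], a descent without end. *)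
Lemma wo_mono_ge (W : wellOrder) (f : W -> W) (x : W) :
  wo_mono f -> ~ wo_lt (f x) x.
Proof.
move=> fm; elim/wo_ind: x => x IH fx.
exact: (IH _ fx (fm _ _ fx)).
Qed.

Lemma ord_le_or_lt (V W : wellOrder) :
  ord_le V W \/
  exists (v : V) (g : W -> V), wo_mono g /\ forall w, wo_lt (g w) v.
Proof.
pose fresh v (f : V -> option W) s := forall u, wo_lt u v -> f u <> Some s.
pose R v f t :=
  if t is Some s then fresh v f s /\ forall s', fresh v f s' -> wo_le s s'
  else ~ exists s, fresh v f s.
have [|v f _|f fR] := @wo_choice V (option W) None R.
- move=> v f g [s|] fg /= => [[fs smin]|nf].
  + split=> [u uv|s' fs']; first by rewrite -fg //; exact: fs.
    by apply: smin => u uv; rewrite fg //; exact: fs'.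
  + by move=> [s fs]; apply: nf; exists s => u uv; rewrite fg //; exact: fs.
- have [/wo_ex_min[s fs smin]|nf] := pselect (exists s, fresh v f s).
    by exists (Some s).
  by exists None.
have flt u v s t : f u = Some s -> f v = Some t -> wo_lt u v -> wo_lt s t.
  move=> fu fv uv; have := fR v; rewrite fv => -[ft _].
  have := fR u; rewrite fu => -[_ smin].
  split; last by move=> st; apply: (ft u uv); rewrite fu st.
  by apply: smin => w wu; apply: ft; exact: wo_lt_trans uv.
have [/wo_ex_min[v fv vmin]|/forallNP allS] := pselect (exists v, f v = None).
- right; exists v.
  have ex s : exists u, wo_lt u v /\ f u = Some s.
    have := fR v; rewrite fv /= => /forallNP/(_ s)/existsNP[u /not_implyP[uv /contrapT]].
    by exists u.
  exists (fun s => projT1 (cid (ex s))); split=> [s t st|s]; last first.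
    by case: cid => /= u [].
  case: cid => /= u [_ fu]; case: cid => /= u' [_ fu'].
  have [//|uu'|u'u] := wo_lt_total u u'.
    move: fu'; rewrite -uu' fu => -[ste]; move: st; rewrite ste.
    by move/wo_ltxx.
  have ts := flt _ _ _ _ fu' fu u'u.
  by case: (wo_ltxx (wo_lt_trans st ts)).
- left; have ex v : exists s, f v = Some s.
    by case: (f v) (allS v) => // s _; exists s.
  pose h v := projT1 (cid (ex v)).
  have hP v : f v = Some (h v) by rewrite /h; case: cid.
  have hm : wo_mono h by move=> u v; exact: flt.
  exists h; split; first exact: wo_mono_embedding.
  move=> v s; have [->|sNhv sv] := pselect (s = h v); first by exists v.
  have := fR v; rewrite hP => -[_ vmin].
  (* An element below [h v] cannot be fresh at [v], so it is an earlier value: the image is an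
     initial segment. *)
  have : ~ fresh v f s.
    by move=> /vmin vs; apply/sNhv/wo_le_anti.
  by move=> /existsNP[u /not_implyP[uv /contrapT]]; rewrite hP => -[<-]; exists u.
Qed.

(** The initial-segment clause of [ord_le] comes for free: the other alternative would yield a
    monotone self-map of [V] moving [v] down. *)
Lemma ord_le_mono (V W : wellOrder) (f : V -> W) : wo_mono f -> ord_le V W.
Proof.
move=> fm; have [//|[v [g [gm gv]]]] := ord_le_or_lt V W.
by case: (@wo_mono_ge V (g \o f) v) => [x y /fm /gm|]; last exact: gv.
Qed.

Lemma ord_le_monoP (V W : wellOrder) :
  ord_le V W -> exists f : V -> W, wo_mono f.
Proof. by move=> [f [/wo_embedding_mono fm _]]; exists f. Qed.

Lemma ord_le_trans (U V W : wellOrder) : ord_le U V -> ord_le V W -> ord_le U W.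
Proof.
move=> /ord_le_monoP[f fm] /ord_le_monoP[g gm].
by apply: (@ord_le_mono _ _ (g \o f)) => x y /fm /gm.
Qed.

Lemma ord_eq_ge (V W : wellOrder) : ord_eq V W -> ord_le W V.
Proof.
move=> [f [fe [g fK gK]]]; apply: (@ord_le_mono _ _ g).
by apply: wo_embedding_mono => x y; rewrite -fe !gK.
Qed.

(** If the initial embedding [f] missed [y], its image would lie below [y], and [f \o g] would move
    [y] down. *)
Lemma ord_le_anti (V W : wellOrder) : ord_le V W -> ord_le W V -> ord_eq V W.
Proof.
move=> [f [fe fini]] /ord_le_monoP[g gm]; exists f; split=> //.
have fm := wo_embedding_mono fe.
have fsurj y : exists x, f x = y.
  apply: contrapT => /forallNP nfy.
  have fy x : wo_lt (f x) y.
    have [//|fxy|[yf _]] := wo_lt_total (f x) y; first by case: (nfy x).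
    by have [x' /nfy] := fini x y yf.
  by case: (@wo_mono_ge W (f \o g) y) => [a b /gm/fm|]; last exact: fy.
have finj x x' : f x = f x' -> x = x'.
  move=> fxx'; have [/fm|//|/fm] := wo_lt_total x x'; rewrite fxx' => /wo_ltxx //.
exists (fun y => projT1 (cid (fsurj y))) => [x|y]; case: cid => //=.
by move=> x' /finj.
Qed.

Lemma least_ordP (P : wellOrder -> Prop) (W : wellOrder) :
  P W -> is_least_ord P (least_ord P).
Proof.
move=> PW; rewrite /least_ord; case: pselect => [e|[]]; first by case: cid.
(* Members of [P] shorter than [W] are measured by points of [W] bounding a copy of them; a least
   such point gives a least member, and if there is none, [W] is least. *)
pose Q (w : W) := exists V, P V /\
  exists g : V -> W, wo_mono g /\ forall x, wo_lt (g x) w.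
have [/wo_ex_min[w [V [PV [g [gm gw]]]] wmin]|nQ] := pselect (exists w, Q w).
- exists V; split=> // U PU; have [//|[v [h [hm hv]]]] := ord_le_or_lt V U.
  have [] : ~ wo_lt (g v) w; last exact: gw.
  apply/wo_leNlt/wmin; exists U; split=> //; exists (g \o h).
  by split=> [x y /hm/gm|x] //; apply/gm/hv.
- exists W; split=> // U PU; have [//|[v hv]] := ord_le_or_lt W U.
  by case: nQ; exists v, U.
Qed.

Lemma ord_min_cases (V W : wellOrder) : ord_min V W = V \/ ord_min V W = W.
Proof.
by have [] := @least_ordP (fun U => U = V \/ U = W) V; first left.
Qed.

(** * Suborders and cardinals *)

Lemma sub_well_order (W : wellOrder) (I : W -> Prop) :
  well_order (fun x y : {x : W | I x} => wo_le (sval x) (sval y)).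
Proof.
apply: antisymmetric_well_order.
  move=> [x Ix] [y Iy] /= /andP[xy yx]; have E := wo_le_anti xy yx.
  by subst y; congr exist; exact: Prop_irrelevance.
move=> A [x Ax]; have [|z [a Aa az] zmin] :=
    @wo_ex_min W (fun z => exists2 a, a \in A & sval a = z).
  by exists (sval x), x.
by exists a; split=> // y yA /=; rewrite az; apply: zmin; exists y.
Qed.

Definition sub_wo (W : wellOrder) (I : W -> Prop) : wellOrder :=
  WellOrder (@sub_well_order W I).

Lemma sub_wo_mono (W : wellOrder) (I : W -> Prop) :
  wo_mono (fun x : sub_wo I => sval x).
Proof. by apply: wo_embedding_mono. Qed.

(** Keeping only the least preimage of each point of [A] leaves a suborder of [W] in bijection with
    [A]. *)
Lemma card_surj_wo (W : wellOrder) (T : Type) (f : W -> T) (A : set T) :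
  (forall a, A a -> exists w, f w = a) ->
  exists V : wellOrder, ord_le V W /\ [set: V] #= A.
Proof.
move=> fA.
pose I w := A (f w) /\ forall u, f u = f w -> wo_le w u.
exists (sub_wo I); split; first exact: ord_le_mono (@sub_wo_mono _ _).
apply/card_bijP.
have fI (x : [set: sub_wo I]) : f (sval (val x)) \in A.
  by apply/mem_set; case: x => -[w []].
pose h (x : [set: sub_wo I]) : A := exist (fun a => a \in A) _ (fI x).
exists h.
have ex (a : A) : exists x, h x = a.
  case: a => a aA; have [|w fw wmin] := @wo_ex_min W (fun w => f w = a).
    by apply: fA; exact/set_mem.
  have Iw : I w by split; [rewrite fw; exact/set_mem | move=> u; rewrite fw; exact: wmin].
  by exists (exist _ (exist _ w Iw : sub_wo I) (mem_set Logic.I)); apply/val_inj.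
exists (fun a => projT1 (cid (ex a))) => [x|a]; case: cid => //= y hy.
have fyx : f (sval (val y)) = f (sval (val x)) by have := congr1 val hy.
apply/val_inj; case: (val y) (val x) fyx => [v [Av vmin]] [u [Au umin]] /= fvu.
have E : v = u by apply: wo_le_anti; [apply: vmin|apply: umin].
by subst v; congr exist; exact: Prop_irrelevance.
Qed.

Lemma cardinal_ofP (T : Type) (A : set T) :
  is_least_ord (fun W => [set: W] #= A) (cardinal_of A).
Proof.
have [R Rwo] := well_ordering_principle {classic T}.
have [|V [_ VA]] := @card_surj_wo (WellOrder Rwo) T id A.
  by move=> a _; exists a.
exact: least_ordP VA.
Qed.

Lemma cardinal_of_le (W : wellOrder) (T : Type) (f : W -> T) (A : set T) :
  (forall a, A a -> exists w, f w = a) -> ord_le (cardinal_of A) W.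
Proof.
move=> /card_surj_wo[V [VW VA]]; apply: ord_le_trans VW.
exact: (cardinal_ofP A).2.
Qed.

Lemma cardinal_of_bij (T : Type) (A : set T) :
  exists f : cardinal_of A -> T,
    [/\ forall w, A (f w), injective f & forall a, A a -> exists w, f w = a].
Proof.
have /card_bijP[g [h gK hK]] := (cardinal_ofP A).1.
have inT (w : cardinal_of A) : w \in [set: cardinal_of A] by exact/mem_set.
exists (fun w => val (g (exist _ w (inT w)))); split.
- by move=> w; apply/set_mem; exact: valP.
- by move=> u v /val_inj/(can_inj gK)/(congr1 val).
- move=> a Aa; exists (val (h (exist _ a (mem_set Aa)))).
  set x := h _; have -> : exist _ (val x) (inT (val x)) = x by exact/val_inj.
  by rewrite hK.
Qed.

(** The continuum is an initial ordinal: otherwise the points below [d] would carry a well-order of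
    its size, and [continuum] would embed into its own proper initial segment. *)
Lemma continuum_small_segment (d : continuum) (h : set nat -> continuum) :
  injective h -> ~ forall Z, wo_lt (h Z) d.
Proof.
move=> hinj hd; pose I (w : continuum) := wo_lt w d.
have [|V [VI cV]] := @card_surj_wo (sub_wo I) (set nat)
   (fun w => if pselect (exists Z, h Z = sval w) is left e then projT1 (cid e)
             else set0) [set: set nat].
  move=> Z _; exists (exist _ (h Z) (hd Z)) => /=.
  by case: pselect => [e|[]]; [case: cid => /= Y /hinj|exists Z].
have /ord_le_monoP[f fm] := ord_le_trans ((cardinal_ofP _).2 _ cV) VI.
apply: (@wo_mono_ge continuum (fun x => sval (f x)) d) => [x y /fm|].
  exact: sub_wo_mono.
exact: (svalP (f d)).
Qed.

(** * Segments modulo finite sets *)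

Lemma finite_natP (A : set nat) :
  finite_set A <-> exists m, forall n, A n -> n < m.
Proof.
split=> [|[m Am]]; last by apply: sub_finite_set (finite_II m) => n /Am.
move=> /finite_seqP[s ->]; exists (\max_(i <- s) i).+1 => n /= ns.
by rewrite ltnS; exact: (@leq_bigmax_seq _ _ xpredT id).
Qed.

Lemma infinite_natP (A : set nat) :
  infinite_set A <-> forall m, exists2 n, m <= n & A n.
Proof.
split=> [Ainf m|Aunb /finite_natP[m Am]].
  apply: contrapT => nA; apply: Ainf; apply/finite_natP; exists m => n An.
  by rewrite ltnNge; apply/negP => mn; apply: nA; exists n.
by have [n mn /Am] := Aunb m; rewrite ltnNge mn.
Qed.

Lemma infinite_range (f : nat -> nat) : injective f -> infinite_set (range f).
Proof.
move=> finj fin; apply: infinite_nat.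
have /finite_preimage/(_ fin) : {in f @^-1` range f &, injective f}.
  by move=> x y _ _ /finj.
by apply: sub_finite_set => x _; exists x.
Qed.

Lemma infinite_enum (E : set nat) : infinite_set E ->
  exists e : nat -> nat, injective e /\ forall n, E n <-> exists k, e k = n.
Proof.
move=> Einf; have /card_esym/card_set_bijP[e [eE einj esurj]] :=
  eq_card_nat (countableP E) Einf.
exists e; split=> [x y|n]; first by apply: einj; exact/mem_set.
by split=> [/esurj[k _ <-]|[k <-]]; [exists k|exact: eE].
Qed.

(* A condition [(E, X)] stands for the segment of the sets that agree with [X]
   off [E], i.e. for [segment (X `\` E) (X `|` E)]; [cube] is its closure under
   finite modifications. *)
Definition cond := (set nat * set nat)%type.

Definition cube (p : cond) (Y : set nat) : Prop :=
  exists m, forall n, m <= n -> ~ p.1 n -> (Y n <-> p.2 n).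

Definition cond_le (p q : cond) : Prop := almost_subset p.1 q.1 /\ cube q p.2.

Definition compatible (p q : cond) : Prop :=
  infinite_set (p.1 `&` q.1) /\ exists2 Y, cube p Y & cube q Y.

Definition nowhere_dense (S : set (set nat)) : Prop :=
  forall g : cond, infinite_set g.1 ->
    exists q, [/\ infinite_set q.1, cond_le q g & forall Y, cube q Y -> ~ S Y].

Lemma almost_subsetP (A B : set nat) :
  almost_subset A B <-> exists m, forall n, m <= n -> A n -> B n.
Proof.
rewrite /almost_subset finite_natP; split=> -[m Am]; exists m => n.
  move=> mn An; apply: contrapT => nB; have := Am n (conj An nB).
  by rewrite ltnNge mn.
by move=> [An nB]; rewrite ltnNge; apply/negP => mn; exact/nB/Am.
Qed.

Lemma almost_subset_trans (A B C : set nat) :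
  almost_subset A B -> almost_subset B C -> almost_subset A C.
Proof.
move=> /almost_subsetP[m AB] /almost_subsetP[k BC]; apply/almost_subsetP.
by exists (m + k) => n mkn An; apply: BC; [lia|apply: AB => //; lia].
Qed.

Lemma subset_almost (A B : set nat) : A `<=` B -> almost_subset A B.
Proof. by move=> AB; apply/almost_subsetP; exists 0 => n _ /AB. Qed.

Lemma infinite_almost_subset (A B : set nat) :
  almost_subset A B -> infinite_set A -> infinite_set (A `&` B).
Proof.
move=> /almost_subsetP[m AB] /infinite_natP Ainf; apply/infinite_natP => k.
by have [n kn An] := Ainf (k + m); exists n; [lia|split=> //; apply: AB => //; lia].
Qed.

Lemma cube_le (p q : cond) (Y : set nat) : cond_le p q -> cube p Y -> cube q Y.
Proof.
move=> [/almost_subsetP[a pq] [b Xpq]] [c Yp]; exists (a + b + c) => n abcn nq.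
have np : ~ p.1 n by move=> pn; apply: nq; apply: pq => //; lia.
by rewrite Yp ?Xpq //; lia.
Qed.

Lemma cond_le_trans (p q r : cond) : cond_le p q -> cond_le q r -> cond_le p r.
Proof.
move=> [pq1 pq2] qr; split; first exact: almost_subset_trans pq1 qr.1.
exact: cube_le qr pq2.
Qed.

Lemma cond_le_refl (p : cond) : cond_le p p.
Proof. by split; [exact: subset_almost|exists 0]. Qed.

Lemma segmentP (E X Y : set nat) :
  segment (X `\` E) (X `|` E) Y <->
  infinite_set Y /\ forall n, ~ E n -> (Y n <-> X n).
Proof.
split=> [[Yinf [XY YX]]|[Yinf YX]].
  split=> // n nE; split=> [/YX[]//|Xn]; by apply: XY.
split=> //; split=> n.
  by move=> [Xn nE]; apply/YX.
by move=> Yn; have [|nE] := pselect (E n); [right|left; apply/YX].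
Qed.

(** [D] lies in its own segment, which gives the upper inclusion. If [n] were in [A] but not in [C],
    the member [D] without [n] would violate the lower one. *)
Lemma segment_sub_ends (A B C D : set nat) : segment_ends C D ->
  segment C D `<=` segment A B -> A `<=` C /\ D `<=` B.
Proof.
move=> [CD CDinf] sub; have Dinf : infinite_set D.
  by move=> /(@sub_finite_set _ (D `\` C)) fin; apply/CDinf/fin => n [].
have /sub[_ [_ DB]] : segment C D D by split; [exact: Dinf|split].
split=> // n An; apply: contrapT => nC.
have : segment C D (D `\ n).
  split; last by split=> k; [move=> Ck; split; [exact: CD|move=> kn; rewrite kn in Ck]|case].
  move=> fin; apply: Dinf; apply: sub_finite_set (_ : finite_set ((D `\ n) `|` [set n])).
    by move=> k Dk; have [->|kn] := pselect (k = n); [right|left; split].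
  by rewrite finite_setU; split.
by move=> /sub[_ [ADn _]]; have [_] := ADn n An; apply.
Qed.

(** * From v^0-sets to nowhere dense sets *)

Lemma v0_strict (S : set (set nat)) (E X : set nat) : v0 S -> infinite_set E ->
  exists E' X', [/\ infinite_set E', E' `<=` E,
    forall n, ~ E n -> (X' n <-> X n) &
    forall Y, (forall n, ~ E' n -> (Y n <-> X' n)) -> ~ S Y].
Proof.
move=> [Sinf Sv] Einf; have [|C [D [CDends CDsub CDS]]] := Sv (X `\` E) (X `|` E).
  split; first by move=> n [Xn _]; left.
  by apply: sub_infinite_set Einf => n En; split; [right|case].
have [XC DX] := segment_sub_ends CDends CDsub.
exists (D `\` C), C; split.
- exact: CDends.2.
- move=> n [Dn nC]; have [Xn|//] := DX n Dn; apply: contrapT => nE.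
  by apply: nC; exact: XC.
- by move=> n nE; split=> [/CDends.1/DX[]//|Xn]; apply: XC.
- move=> Y YC SY; suff : (segment C D `&` S) Y by rewrite CDS.
  split=> //; split; first exact: Sinf.
  split=> n.
    by move=> Cn; apply/YC => // -[].
  move=> Yn; apply: contrapT => nD.
  have nDC : ~ (D `\` C) n by case.
  by apply/nD/CDends.1/(YC n nDC).
Qed.

(** Induction on [m], treating all prefixes below [m] at once. In the step [m] is taken out of the
    free set, and the induction hypothesis is used twice, with [m] in the pattern and then with [m]
    out of it. *)
Lemma v0_avoid_prefix (S : set (set nat)) (m : nat) (E X : set nat) :
  v0 S -> infinite_set E ->
  exists E' X', [/\ infinite_set E', E' `<=` E,
    forall n, m <= n -> ~ E n -> (X' n <-> X n) &
    forall Y, (forall n, m <= n -> ~ E' n -> (Y n <-> X' n)) -> ~ S Y].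
Proof.
move=> Sv; elim: m E X => [|m IH] E X Einf.
  have [E' [X' [E'inf E'E X'X X'S]]] := v0_strict X Sv Einf.
  exists E', X'; split=> // [n _|Y YX']; first exact: X'X.
  by apply: X'S => n; exact: YX'.
have E0inf : infinite_set (E `\ m).
  move: Einf => /infinite_natP Einf; apply/infinite_natP => k.
  by have [n kn En] := Einf (k + m.+1); exists n; [lia|split=> //= nm; lia].
have [E1 [X1 [E1inf E10 X10 X1S]]] := IH _ (m |` X) E0inf.
have [E2 [X2 [E2inf E21 X21 X2S]]] := IH _ (X1 `\ m) E1inf.
have nE1m : ~ E1 m by move=> /E10[_]; apply.
have X1m : X1 m by apply/X10 => //; [case=> _; apply|left].
have nX2m : ~ X2 m by move=> /(X21 m (leqnn m) nE1m)[_]; apply.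
exists E2, X2; split=> // [n /E21/E10[]//|n mn nE|Y YX2].
  have nE1 : ~ E1 n by move=> /E10[].
  have nE0 : ~ (E `\ m) n by case.
  rewrite X21 //; last lia.
  have nm : n <> m by lia.
  split=> [[/X10]|Xn]; first by move=> /(_ ltac:(lia) nE0)[].
  by split=> //; apply/X10 => //; [lia|right].
(* Membership of [m] in [Y] decides which of the two applications excludes [Y]. *)
have [Ym|nYm] := pselect (Y m); [apply: X1S|apply: X2S] => n; rewrite leq_eqVlt.
  move=> /predU1P[<-//|mn] nE1.
  have nE2 : ~ E2 n by move=> /E21.
  rewrite YX2 // X21 //; last lia.
  by split=> [[]//|X1n]; split=> //= nm; lia.
by move=> /predU1P[<-//|mn] nE2; exact: YX2.
Qed.

Lemma nat_intervals (m : nat -> nat) (n : nat) :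
  m 0 = 0 -> (forall k, m k < m k.+1) -> exists j, m j <= n < m j.+1.
Proof.
move=> m0 minc; elim: n => [|n [j jn]]; first by exists 0; have := minc 0; lia.
have [nj|nj] := ltnP n.+1 (m j.+1); first by exists j; lia.
by exists j.+1; have := minc j.+1; lia.
Qed.

Lemma homo_incr (m : nat -> nat) :
  (forall k, m k < m k.+1) -> forall i j, i <= j -> m i <= m j.
Proof.
move=> minc i j /subnK <-; elim: (j - i) => // k IH.
by rewrite addSn; have := minc (k + i); lia.
Qed.

Lemma le_incr (m : nat -> nat) :
  (forall k, m k < m k.+1) -> forall k, k <= m k.
Proof. by move=> minc; elim=> // k IH; have := minc k; lia. Qed.

(* Fusion: the [k]-th step fixes everything on the interval from [m k] to
   [m k.+1] except its last point, and treats all prefixes below [m k] at once. *)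
Lemma v0_nowhere_dense (S : set (set nat)) : v0 S -> nowhere_dense S.
Proof.
move=> Sv [E0 X0] /= E0inf.
(* A stage is a bound with a free set and a pattern. The point [t.1.-1] is the one kept free in the
   new interval; the last clause excludes [Y] whatever it does below [s.1]. *)
pose next (s t : nat * cond) := [/\ t.2.1 `<=` s.2.1, infinite_set t.2.1,
  s.1 < t.1 /\ t.2.1 t.1.-1,
  forall n, s.1 <= n -> ~ s.2.1 n -> (t.2.2 n <-> s.2.2 n) &
  forall Y, (forall n, s.1 <= n -> ~ t.2.1 n -> (Y n <-> t.2.2 n)) -> ~ S Y].
have nextP (s : nat * cond) : {t | infinite_set s.2.1 -> next s t}.
  apply: cid; case: s => m [E X] /=.
  (* The value for finite [E] is arbitrary; by [sinf] it is never reached. *)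
  have [Einf|nEinf] := pselect (infinite_set E); last by exists (0, (E, X)).
  have [E' [X' [E'inf E'E X'X X'S]]] := v0_avoid_prefix m X Sv Einf.
  have [n mn E'n] := (infinite_natP E').1 E'inf m.
  by exists (n.+1, (E', X')).
pose s := fix s k := if k is k'.+1 then sval (nextP (s k')) else (0, (E0, X0)).
have sinf k : infinite_set (s k).2.1.
  by elim: k => //= k IH; have [] := svalP (nextP (s k)) IH.
have sP k : next (s k) (s k.+1) := svalP (nextP (s k)) (sinf k).
pose m k := (s k).1; pose E k := (s k).2.1; pose X k := (s k).2.2.
have minc k : m k < m k.+1 by have [_ _ [? _]] := sP k.
have mle := homo_incr minc.
have Esub i j : i <= j -> E j `<=` E i.
  move=> /subnK <-; elim: (j - i) => // k IH n; rewrite addSn.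
  by have [+ _ _ _ _] := sP (k + i) => /[apply] /IH.
have Xeq i j n : i <= j -> m j <= n -> ~ E i n -> (X j.+1 n <-> X i n).
  move=> ij; move: (ij) => /subnK <-; elim: (j - i) => [|k IH].
    by rewrite add0n => mn nE; have [_ _ _ + _] := sP i; exact.
  rewrite addSn => mn nE; have [_ _ _ + _] := sP (k + i).+1.
  move=> /(_ n mn) H; apply: (iff_trans (H _)).
    by move=> En; apply: nE; apply: (Esub i (k + i).+1 _ n En); lia.
  by apply: IH => //; have := minc (k + i); lia.
(* The fused condition: the last points of the intervals are free, and on the [j]-th interval the
   pattern is the one produced by step [j]. *)
pose Ew n := exists j, n = (m j.+1).-1.
pose Xw n := exists2 j, m j <= n < m j.+1 & X j.+1 n.
have juniq i j n : m i <= n < m i.+1 -> m j <= n < m j.+1 -> i = j.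
  move=> ni nj; have [ij|ji|//] := ltngtP i j.
    by have := mle _ _ ij; lia.
  by have := mle _ _ ji; lia.
have XwE j n : m j <= n < m j.+1 -> (Xw n <-> X j.+1 n).
  move=> nj; split=> [[i ni]|Xn]; last by exists j.
  by rewrite (juniq _ _ _ ni nj).
have Ewj j : E j.+1 (m j.+1).-1 by have [_ _ [_ ?] _ _] := sP j.
have int n := nat_intervals n (erefl : m 0 = 0) minc.
(* The free point of interval [j] lies in [E j.+1], hence in [E k.+1] for all [k <= j]. *)
have Ewnot k j n : k <= j -> m j <= n < m j.+1 -> ~ E k.+1 n -> ~ Ew n.
  move=> kj nj nE [i ni]; apply: nE.
  have ij : i = j by apply: juniq nj; rewrite ni; have := minc i; lia.
  by rewrite ni; apply: Esub (Ewj i); lia.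
exists (Ew, Xw); split.
- apply/infinite_natP => k; exists (m k.+1).-1; last by exists k.
  by have := le_incr minc k.+1; lia.
- split; first by apply: subset_almost => n [j ->]; exact: (Esub 0 j.+1).
  exists 0 => n _ /= nE; have [j nj] := int n.
  by rewrite (XwE _ _ nj) (Xeq 0) //; lia.
(* [Y] may deviate below [k0], but [k0 <= m k0], so step [k0] excludes it. *)
- move=> Y [k0 /= Yk0]; have [_ _ _ _ +] := sP k0; apply => n k0n nE.
  have [j nj] := int n.
  have k0j : k0 <= j.
    by rewrite leqNgt; apply/negP => jk; have := mle _ _ jk; have : m k0 <= n := k0n; lia.
  rewrite Yk0; [|by have := le_incr minc k0; have : m k0 <= n := k0n; lia|exact: Ewnot k0j nj nE].
  rewrite (XwE _ _ nj); move: k0j; rewrite leq_eqVlt => /predU1P[->//|k0j].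
  by apply: Xeq => //; lia.
Qed.

(** A refinement [q] of the given segment is one only modulo finite sets; cutting its free set down
    to [B] minus [A] and resetting its pattern to [A] elsewhere gives a true subsegment. *)
Lemma nowhere_dense_v0 (S : set (set nat)) :
  S `<=` infinite_sets -> nowhere_dense S -> v0 S.
Proof.
move=> Sinf Snd; split=> // A B [AB BAinf].
have [q [qinf [qB [a qA]] qS]] := Snd (B `\` A, A) BAinf.
rewrite /= in qB qA.
pose E := q.1 `&` (B `\` A); pose X := A `|` (q.2 `&` B).
have Einf : infinite_set E by exact: infinite_almost_subset.
have XA n : ~ (B `\` A) n -> (X n <-> A n).
  by move=> nBA; split=> [[//|[_ Bn]]|An]; [apply: contrapT => nA; exact: nBA|left].
exists (X `\` E), (X `|` E); split.
- split; first by move=> n [Xn _]; left.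
  by apply: sub_infinite_set Einf => n En; split; [right|case].
- move=> Y /segmentP[Yinf YX]; split=> //; split=> n.
    by move=> An; apply/YX; [case=> _ []|left].
  move=> Yn; apply: contrapT => nB.
  have nE : ~ E n by move=> [_ []].
  by move/(YX n nE): Yn => [/AB//|[_ //]].
- apply/seteqP; split=> // Y [/segmentP[Yinf YX]] /= /qS; apply.
  have /almost_subsetP[b qb] := qB.
  exists (a + b) => n abn nq; rewrite YX; last by case.
  have [BAn|nBA] := pselect ((B `\` A) n).
    by split=> [[An|[]//]|qn]; [case: BAn|right; split=> //; case: BAn].
  by rewrite XA // -qA //; lia.
Qed.

(** The free set is divided into infinitely many infinite columns. Column 0 stays free and column
    [i.+1] is filled or emptied according to [Z i], so distinct [Z] disagree on almost all of some
    column. *)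
Lemma cond_splitting (g : cond) : infinite_set g.1 ->
  exists G : set nat -> cond, [/\ forall Z, infinite_set (G Z).1,
    forall Z, cond_le (G Z) g &
    forall Z Z' Y Y', Z <> Z' -> cube (G Z) Y -> cube (G Z') Y' ->
      infinite_set [set n | g.1 n /\ ~ (Y n <-> Y' n)]].
Proof.
move=> /infinite_enum[e [einj eE]].
pose c (i j : nat) := e (pickle (i, j)).
have cinj i j i' j' : c i j = c i' j' -> i = i' /\ j = j'.
  by move=> /einj/(pcan_inj pickleK)[].
pose E n := exists j, c 0 j = n.
pose X (Z : set nat) n := (~ g.1 n /\ g.2 n) \/ exists i j, Z i /\ c i.+1 j = n.
have cg i j : g.1 (c i j) by apply/eE; exists (pickle (i, j)).
have XE Z i j : X Z (c i.+1 j) <-> Z i.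
  split=> [[[/(_ (cg _ _))]//|[i' [j' [Zi' /cinj[[<-]]]]]]//|Zi].
  by right; exists i, j.
have diff (Z Z' Y Y' : set nat) i : Z i -> ~ Z' i -> cube (E, X Z) Y ->
    cube (E, X Z') Y' -> infinite_set [set n | g.1 n /\ (Y n /\ ~ Y' n)].
  move=> Zi nZ'i [a Ya] [b Y'b]; apply/infinite_natP => m.
  have /infinite_natP/(_ (m + a + b))[n mn [j _ jn]] :
      infinite_set (range (c i.+1)).
    by apply: infinite_range => j j' /cinj[].
  have nE : ~ E n by rewrite -jn => -[k /cinj[]].
  exists n; first lia.
  split; first by rewrite -jn.
  have an : a <= n by lia.
  have bn : b <= n by lia.
  by split; [apply/(Ya n an nE)|move/(Y'b n bn nE)]; rewrite /= -jn XE.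
exists (fun Z => (E, X Z)); split=> /= [Z|Z|Z Z' Y Y' ZZ' YZ Y'Z'].
- have : infinite_set (range (c 0)) by apply: infinite_range => j j' /cinj[].
  by apply: sub_infinite_set => n [j _ jn]; exists j.
- split; first by apply: subset_almost => n [j <-].
  exists 0 => n _ ng; split=> [[[]//|[i [j [_ in_]]]]|gn]; last by left.
  by rewrite -in_ in ng.
- have [i Zi] : exists i, ~ (Z i <-> Z' i).
    by apply/existsNP => ZZ; apply: ZZ'; apply/seteqP; split=> i /ZZ.
  have {Zi} [[Zi nZi]|[nZi Zi]] : (Z i /\ ~ Z' i) \/ (~ Z i /\ Z' i).
    by case: (pselect (Z i)) (pselect (Z' i)) => ? [] ?; tauto.
    by apply: sub_infinite_set (diff _ _ _ _ _ Zi nZi YZ Y'Z') => n [gn Yn]; split=> //; tauto.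
  by apply: sub_infinite_set (diff _ _ _ _ _ Zi nZi Y'Z' YZ) => n [gn Yn]; split=> //; tauto.
Qed.

(** * The base matrix *)

(** A maximal antichain of a strong kind: the cubes themselves are disjoint, so a point selects at
    most one member. Incompatible conditions may still have common points when their free sets are
    almost disjoint. *)
Definition disjoint_base (D P : cond -> Prop) : Prop :=
  [/\ forall p, P p -> infinite_set p.1 /\ D p,
      forall p q Y, P p -> P q -> cube p Y -> cube q Y -> p = q &
      forall g, infinite_set g.1 -> exists2 p, P p & compatible p g].

Lemma continuum_enum_cond : exists c : continuum -> cond, forall p, exists w, c w = p.
Proof.
have [f [_ _ fsurj]] := cardinal_of_bij [set: set nat].
exists (fun w => ([set n | f w n.*2], [set n | f w n.*2.+1])) => -[E X].
have [//|w fw] := fsurj [set n | if odd n then X n./2 else E n./2].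
exists w; rewrite fw; congr pair; apply/seteqP; split=> n /=;
  by rewrite ?odd_double /= ?doubleK ?uphalf_double.
Qed.

(* Recursion along an enumeration [g] of the conditions in type [continuum]:
   unless [g w] is compatible with an earlier choice, it has continuum many
   refinements of which each earlier cube meets at most one. *)
Lemma disjoint_base_exists (D : cond -> Prop) :
  (forall g, infinite_set g.1 ->
    exists q, [/\ infinite_set q.1, cond_le q g & D q]) ->
  exists P, disjoint_base D P.
Proof.
move=> Ddense; have [c csurj] := continuum_enum_cond.
(* Pairs with finite free set are replaced by the condition of the whole space. *)
pose g w := if pselect (infinite_set (c w).1) is left _ then c w else (setT, setT).
have ginf w : infinite_set (g w).1.
  by rewrite /g; case: (pselect (infinite_set (c w).1)) => // _; exact: infinite_nat.
pose R w (f : continuum -> cond) t := [/\ infinite_set t.1, D t, compatible t (g w) &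
  forall u, wo_lt u w -> f u = t \/ forall Y, cube (f u) Y -> ~ cube t Y].
have [|w f fR|f fR] := @wo_choice continuum cond (setT, setT) R.
- move=> w f f' t ff' [tinf Dt tg ft]; split=> // u uw.
  by rewrite -ff' //; exact: ft.
(* A compatible earlier choice is simply repeated, which is why [R] allows [f u = t]. *)
- have [[u uw ug]|nocompat] :=
    pselect (exists2 u, wo_lt u w & compatible (f u) (g w)).
    have [uinf Du _ fu] := fR u uw; exists (f u); split=> // v vw.
    have [vu|->|uv] := wo_lt_total v u; [exact: fu|by left|].
    have [_ _ _ /(_ u uv) [->|disj]] := fR v vw; first by left.
    by right=> Y Yv Yu; exact: disj Yu Yv.
  have [G [Ginf Gg Gdiff]] := cond_splitting (ginf w).
  (* If every cube of the splitting met an earlier one, two of them meeting the same [f u] would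
     force its free set to meet that of [g w] infinitely often. So [Z] would inject into the indices
     below [w]. *)
  have [Z GZ] : exists Z, forall u, wo_lt u w -> forall Y, cube (f u) Y -> ~ cube (G Z) Y.
    apply: contrapT => /forallNP nG.
    have ex Z : exists u, wo_lt u w /\ exists2 Y, cube (f u) Y & cube (G Z) Y.
      have /existsNP[u /not_implyP[uw /existsNP[Y /not_implyP[Yu /contrapT YG]]]] := nG Z.
      by exists u; split=> //; exists Y.
    have [h hP] := choice ex.
    apply: (@continuum_small_segment w h) => [Z Z' hZ|Z]; last by case: (hP Z).
    apply: contrapT => ZZ'.
    have [hw [Y [a Ya] YG]] := hP Z; have [_ [Y' [b Y'b] Y'G]] := hP Z'.
    rewrite -hZ in Y'b; apply: nocompat; exists (h Z) => //; split.
      apply/infinite_natP => m.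
      have /infinite_natP/(_ (m + a + b))[n mn [gn YY'n]] := Gdiff _ _ _ _ ZZ' YG Y'G.
      exists n; first lia.
      split=> //; apply: contrapT => nf; apply: YY'n.
      by rewrite Ya ?Y'b //; lia.
    by exists Y; [exists a|exact: cube_le YG].
  have [q [qinf qG Dq]] := Ddense _ (Ginf Z).
  have qg := cond_le_trans qG (Gg Z).
  exists q; split=> //.
    split; first exact: infinite_almost_subset qg.1 qinf.
    by exists q.2; [exists 0|exact: qg.2].
  by move=> u uw; right=> Y Yu Yq; apply: GZ Yu _ => //; exact: cube_le Yq.
exists (range f); split.
- by move=> _ [w _ <-]; have [] := fR w.
- move=> _ _ Y [u _ <-] [w _ <-] Yu Yw; have [uw|->//|wu] := wo_lt_total u w.
    by have [_ _ _ /(_ u uw)[//|/(_ Y Yu)]] := fR w.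
  by have [_ _ _ /(_ w wu)[//|/(_ Y Yw)]] := fR u.
- move=> p pinf; have [w cw] := csurj p; exists (f w); first by exists w.
  by have [_ _ + _] := fR w; rewrite /g cw; case: (pselect (infinite_set p.1)).
Qed.

(* The cubes of [g] and of the whole space are isomorphic. *)
Lemma local_uncovered (W : wellOrder) (N : W -> set (set nat)) (g : cond) :
  (forall M : W -> set (set nat), (forall w, v0 (M w)) ->
    exists2 Z, infinite_set Z & forall w, ~ M w Z) ->
  infinite_set g.1 ->
  (forall w h, infinite_set h.1 -> cond_le h g ->
    exists q, [/\ infinite_set q.1, cond_le q h & forall Y, cube q Y -> ~ N w Y]) ->
  exists2 Y, cube g Y & forall w, ~ N w Y.
Proof.
move=> Wcov ginf Nnd; have [e [einj eE]] := infinite_enum ginf.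
(* [phi] copies [Z] onto the free set of [g] along the enumeration [e]. *)
pose phi (Z : set nat) n :=
  (exists2 k, e k = n & Z k) \/ (~ g.1 n /\ g.2 n).
have phie Z k : phi Z (e k) <-> Z k.
  split=> [[[j /einj <-//]|[]]|Zk]; last by left; exists k.
  by case; apply/eE; exists k.
have phig Z n : ~ g.1 n -> (phi Z n <-> g.2 n).
  move=> ng; split=> [[[k kn]|[]//]|gn]; last by right.
  by case: ng; apply/eE; exists k.
pose M w Z := infinite_set Z /\ N w (phi Z).
have [|Z Zinf ZM] := Wcov M; last first.
  exists (phi Z) => [|w NZ]; last exact: (ZM w).
  by exists 0 => n _; exact: phig.
move=> w; apply: nowhere_dense_v0 => [Z []//|[E X] /= Einf].
pose p : cond := ([set n | exists2 k, e k = n & E k], phi X).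
have pinf : infinite_set p.1.
  move=> pfin; apply: Einf.
  have /finite_preimage/(_ pfin) : {in e @^-1` p.1 &, injective e} by move=> x y _ _ /einj.
  by apply: sub_finite_set => k Ek; exists k.
have pg : cond_le p g.
  split; first by apply: subset_almost => n [k kn _]; apply/eE; exists k.
  by exists 0 => n _; exact: phig.
have [q [qinf qp qN]] := Nnd w p pinf pg.
(* The pullback of [q] along [e], with the pattern reset to [X] off [E] because [q] refines [p] only
   modulo finite sets. *)
pose E' k := E k /\ q.1 (e k).
pose X' k := (E k /\ q.2 (e k)) \/ (~ E k /\ X k).
exists (E', X'); split.
- move=> /= E'fin; apply: (infinite_almost_subset qp.1 qinf).
  apply: sub_finite_set (finite_image e E'fin) => n [qn [k kn Ek]].
  by exists k => //; split=> //; rewrite kn.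
- split; first by apply: subset_almost => k [].
  by exists 0 => k _ /= nEk; rewrite /X'; tauto.
- move=> Z [a Za] [Zinf]; apply: qN; have [c qc] := qp.2.
  (* Beyond [b] only values [e k] with [a <= k] occur. *)
  have /finite_natP[b eb] := finite_image e (finite_II a).
  exists (b + c) => n bcn nq.
  have cn : c <= n by lia.
  have [/eE[k kn]|ng] := pselect (g.1 n); last first.
    rewrite phig // -(phig X) // qc //.
    by move=> [k kn _]; apply: ng; apply/eE; exists k.
  have ak : a <= k.
    rewrite leqNgt; apply/negP => ka; have : n < b by apply: eb; exists k.
    by lia.
  rewrite -kn in nq cn *; rewrite phie.
  have nE' : ~ E' k by case.
  rewrite (Za k ak nE') /= /X'; have [Ek|nEk] := pselect (E k); first tauto.
  rewrite (qc _ cn) /= ?phie; first tauto.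
  by move=> [j /einj ->].
Qed.

(** The order of the arguments is the one [wo_choice] expects: index, earlier rows, new row. *)
Definition matrix_row (W : wellOrder) (S : W -> set (set nat)) (w : W)
    (P : W -> cond -> Prop) : (cond -> Prop) -> Prop :=
  disjoint_base (fun p => (forall Y, cube p Y -> ~ S w Y) /\
    forall u, wo_lt u w -> exists2 p', P u p' & cond_le p p').

(* A point lying in the cubes of all rows selects one condition in each row.
   These conditions form a decreasing sequence, and the point uniformizes their
   second components, so a pseudo-intersection of the first components gives a
   lower bound: no Hausdorff gap can occur. *)
Lemma matrix_branch (W : wellOrder) (S : W -> set (set nat))
    (P : W -> cond -> Prop) (I : W -> Prop) (g : cond) :
  (forall M : W -> set (set nat), (forall w, v0 (M w)) ->
    exists2 Z, infinite_set Z & forall w, ~ M w Z) ->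
  (forall T : W -> set nat, (forall u, I u -> infinite_set (T u)) ->
    (forall u v, I u -> I v -> wo_lt u v -> almost_subset (T v) (T u)) ->
    exists2 E, infinite_set E & forall u, I u -> almost_subset E (T u)) ->
  (forall u, I u -> matrix_row S u P (P u)) ->
  infinite_set g.1 ->
  exists q, [/\ infinite_set q.1, cond_le q g &
    forall u, I u -> exists2 p, P u p & cond_le q p].
Proof.
move=> Wcov Wtow PI ginf.
have [[u0 Iu0]|nI] := pselect (exists u, I u); last first.
  exists g; split=> // [|u Iu]; first exact: cond_le_refl.
  by case: nI; exists u.
(* The points that row [u] misses near [g]; maximality of the row makes this set nowhere dense below
   [g]. *)
pose N u Y := I u /\ ~ exists p, [/\ P u p, compatible p g & cube p Y].
have [|Y Yg YN] := @local_uncovered W N g Wcov ginf.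
  move=> u h hinf hg; have [Iu|nIu] := pselect (I u); last first.
    by exists h; split=> // [|Y _ []//]; exact: cond_le_refl.
  have [_ _ /(_ h hinf)[p Pp [phinf [X Xp Xh]]]] := PI u Iu.
  exists (p.1 `&` h.1, X); split=> //.
    by split=> //; apply: subset_almost => n [].
  move=> Y [a Ya] [_]; apply; exists p; split=> //.
    split; last by exists X => //; exact: cube_le Xh.
    have : almost_subset (p.1 `&` h.1) g.1.
      by apply: almost_subset_trans hg.1; apply: subset_almost => n [].
    move=> /infinite_almost_subset/(_ phinf); apply: sub_infinite_set.
    by move=> n [[]].
  move: Xp => [b Xb]; exists (a + b) => n abn np.
  by rewrite Ya /= ?Xb //; [lia|lia|case].
have ex u : exists p, I u -> [/\ P u p, compatible p g & cube p Y].
  have [Iu|nIu] := pselect (I u); last by exists g.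
  by have /not_andP[//|/contrapT[p ?]] := YN u; exists p.
have [p pP] := choice ex.
have [u Iu|u v Iu Iv uv|E Einf ET] := Wtow (fun u => (p u).1 `&` g.1).
- by have [_ []] := pP u Iu.
- have [Pu _ Yu] := pP u Iu; have [Pv _ Yv] := pP v Iv.
  have [/(_ _ Pv)[_ [_ /(_ u uv)[p' Pp' vp']]] _ _] := PI v Iv.
  have [_ uniq _] := PI u Iu.
  (* The member of row [u] above [p v] also has [Y] in its cube, so by disjointness it is [p u]. *)
  have p'E := uniq _ _ Y Pp' Pu (cube_le vp' Yv) Yu; subst p'.
  have /almost_subsetP[m mvu] := vp'.1.
  by apply/almost_subsetP; exists m => n mn [vn gn]; split=> //; exact: mvu.
- have Esub u : I u -> almost_subset E (p u).1 /\ almost_subset E g.1.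
    by move=> Iu; split; apply: almost_subset_trans (ET u Iu) _;
      apply: subset_almost => k [].
  (* [Y] serves as pattern since it lies in all the selected cubes. *)
  exists (E, Y); split=> // [|u Iu].
    by split=> //; have [] := Esub u0 Iu0.
  have [Pu _ Yu] := pP u Iu; exists (p u) => //.
  by split=> //; have [] := Esub u Iu.
Qed.

(** Rows are built by recursion: a branch through the rows before [w], refined to avoid [S w], shows
    that row [w] exists. A branch through all rows then avoids the union. Both uses of
    [matrix_branch] explain the arbitrary index set [I]. *)
Lemma nowhere_dense_bigcup (W : wellOrder) (S : W -> set (set nat)) :
  (forall M : W -> set (set nat), (forall w, v0 (M w)) ->
    exists2 Z, infinite_set Z & forall w, ~ M w Z) ->
  (forall (I : W -> Prop) (T : W -> set nat),
    (forall u, I u -> infinite_set (T u)) ->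
    (forall u v, I u -> I v -> wo_lt u v -> almost_subset (T v) (T u)) ->
    exists2 E, infinite_set E & forall u, I u -> almost_subset E (T u)) ->
  (forall w, nowhere_dense (S w)) ->
  nowhere_dense (fun Y => exists w, S w Y).
Proof.
move=> Wcov Wtow Snd.
have [|w P PR|P PR] := @wo_choice W (cond -> Prop) (fun=> True) (matrix_row S).
- move=> w P P' Q PP' [PD Pdisj Pcompat]; split=> // p Qp.
  have [pinf [pS pP]] := PD p Qp; split=> //; split=> // u uw.
  by rewrite -PP' //; exact: pP.
- apply: disjoint_base_exists => g ginf.
  have [q [qinf qg qP]] := matrix_branch Wcov (Wtow _) PR ginf.
  have [r [rinf rq rS]] := Snd w q qinf.
  exists r; split=> //; first exact: cond_le_trans qg.
  split=> // u uw; have [p Pp qp] := qP u uw; exists p => //.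
  exact: cond_le_trans qp.
- move=> g ginf; have [||q [qinf qg qP]] :=
    @matrix_branch W S P (fun=> True) g Wcov (Wtow _) => //.
  exists q; split=> // Y Yq [w SY]; have [p Pp qp] := qP w Logic.I.
  by have [/(_ p Pp)[_ [/(_ Y)]]] := PR w; move/(_ (cube_le qp Yq)).
Qed.

(** * Cardinal bounds *)

Lemma cov_v0_le (W : wellOrder) (f : W -> set (set nat)) :
  (forall w, v0 (f w)) -> (forall Z, infinite_set Z -> exists w, f w Z) ->
  ord_le cov_v0 W.
Proof.
move=> fv0 fcov; pose F := range f.
apply: (@ord_le_trans _ (cardinal_of F)).
  have PF : exists F' : set (set (set nat)),
      [/\ F' `<=` v0, \bigcup_(S in F') S = infinite_sets &
          cardinal_of F = cardinal_of F'].
    exists F; split=> // [_ [w _ <-]//|].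
    apply/seteqP; split=> Z; first by move=> [_ [w _ <-] /((fv0 w).1)].
    by move=> /fcov[w fwZ]; exists (f w) => //; exists w.
  exact: (least_ordP PF).2 PF.
by apply: (@cardinal_of_le _ _ f) => _ [w _ <-]; exists w.
Qed.

(** * The bound by the cofinality of the continuum *)

Lemma splitting_cubes_disjoint (g : cond) (G : set nat -> cond) (Z Z' Y : set nat) :
  (forall Z Z' Y Y', Z <> Z' -> cube (G Z) Y -> cube (G Z') Y' ->
      infinite_set [set n | g.1 n /\ ~ (Y n <-> Y' n)]) ->
  cube (G Z) Y -> cube (G Z') Y -> Z = Z'.
Proof.
move=> Gdiff YZ YZ'; apply: contrapT => /Gdiff/(_ YZ YZ')/infinite_natP/(_ 0).
by case=> n _ [_]; apply.
Qed.

Lemma nowhere_dense1 (X : set nat) : nowhere_dense [set X].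
Proof.
move=> g /cond_splitting[G [Ginf Gg Gdiff]].
have [X0|nX0] := pselect (cube (G set0) X); last first.
  by exists (G set0); split=> // Y YG YX; apply: nX0; rewrite -YX.
exists (G setT); split=> // Y YG YX; rewrite YX in YG.
have E : set0 = setT := splitting_cubes_disjoint Gdiff X0 YG.
have : setT 0 by [].
by rewrite -E.
Qed.

Lemma nowhere_denseU (S T : set (set nat)) :
  nowhere_dense S -> nowhere_dense T -> nowhere_dense (S `|` T).
Proof.
move=> Snd Tnd g /Snd[p [/Tnd[q [qinf qp qT]] pg pS]].
exists q; split=> //; first exact: cond_le_trans pg.
by move=> Y Yq [/pS|/qT]; apply=> //; exact: cube_le Yq.
Qed.

(** Below [g] there are continuum many disjoint cubes, so fewer points cannot meet all of them. *)
Lemma nowhere_dense_small (phi : continuum -> set nat) (d : continuum) :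
  nowhere_dense [set phi x | x in [set x | wo_lt x d]].
Proof.
move=> g /cond_splitting[G [Ginf Gg Gdiff]].
have [Z GZ] : exists Z, forall x, wo_lt x d -> ~ cube (G Z) (phi x).
  apply: contrapT => /forallNP nG.
  have ex Z : exists x, wo_lt x d /\ cube (G Z) (phi x).
    by have /existsNP[x /not_implyP[xd /contrapT]] := nG Z; exists x.
  have [h hP] := choice ex.
  apply: (@continuum_small_segment d h) => [Z Z' hZ|Z]; last by case: (hP Z).
  apply: (splitting_cubes_disjoint Gdiff) (hP Z).2 _.
  by rewrite hZ; exact: (hP Z').2.
by exists (G Z); split=> // Y YG [x xd xY]; apply: (GZ x) => //; rewrite xY.
Qed.

Lemma cov_v0_le_cofinality : ord_le cov_v0 (cofinality continuum).
Proof.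
have : exists2 D : set continuum, cofinal D & cardinal_of (@setT continuum) = cardinal_of D.
  by exists setT => // x; exists x => //; exact: wo_le_refl.
move=> /(least_ordP (P := fun K => exists2 D, cofinal D & K = cardinal_of D)).
rewrite -/(cofinality continuum) => -[[D Dcof ->] _].
have [f [_ _ fsurj]] := cardinal_of_bij D.
have [phi [_ _ phisurj]] := cardinal_of_bij [set: set nat].
(* The reals are cut into initial parts indexed by a cofinal set; the singleton is added because
   cofinality gives only a non-strict bound. *)
apply: (@cov_v0_le _ (fun w => infinite_sets `&`
  ([set phi x | x in [set x | wo_lt x (f w)]] `|` [set phi (f w)]))) => [w|Z Zinf].
  apply: nowhere_dense_v0 => [Z []//|g ginf].
  have [q [qinf qg qS]] := nowhere_denseU (@nowhere_dense_small phi (f w))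
    (@nowhere_dense1 (phi (f w))) ginf.
  by exists q; split=> // Y /qS nS [_ /nS].
have [x xZ] := phisurj Z Logic.I; have [d Dd xd] := Dcof x.
have [w wd] := fsurj d Dd; exists w; split=> //; rewrite wd.
have [xdE|xNd] := pselect (x = d); first by right; rewrite -xdE.
by left; exists x.
Qed.

(** * The bound by the reaping number *)

Fixpoint parity (Z : set nat) (n : nat) : bool :=
  if n is n'.+1 then parity Z n' (+) `[< Z n' >] else false.

(** The exclusive or of the two values is the parity of the number of points of [Z] in the interval
    from [a] to [b]. *)
Lemma parity_agree (Z Z' : set nat) (a b : nat) : a <= b ->
  (forall n, a <= n < b -> (Z n <-> Z' n)) ->
  parity Z a (+) parity Z b = parity Z' a (+) parity Z' b.
Proof.
move=> /subnK <-; elim: (b - a) => [|k IH] agree; first by rewrite !addbb.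
rewrite addSn /= !addbA IH => [|n nk]; last by apply: agree; lia.
by congr addb; apply: asbool_equiv_eq; apply: agree; lia.
Qed.

Lemma parity_flip (Z Z' : set nat) (a x b : nat) : a <= x < b ->
  (forall n, a <= n < b -> n <> x -> (Z n <-> Z' n)) -> (Z x <-> ~ Z' x) ->
  parity Z a (+) parity Z b = ~~ (parity Z' a (+) parity Z' b).
Proof.
move=> axb agree flip.
have := @parity_agree Z Z' a x ltac:(lia) ltac:(move=> n nax; apply: agree; lia).
have := @parity_agree Z Z' x.+1 b ltac:(lia) ltac:(move=> n nax; apply: agree; lia).
rewrite /= (asbool_equiv_eq flip) asbool_neg.
by case: (parity Z a) (parity Z x) (parity Z b) (parity Z' a) (parity Z' x)
  (parity Z' b) `[< Z' x >] => [] [] [] [] [] [] [].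
Qed.

(** Parity is essential: no member of a segment whose lower end contains [R] splits [R] itself, so
    the sets not splitting [R] need not form a v^0-set. *)
Definition not_split (R : set nat) : set (set nat) :=
  [set Z | infinite_set Z /\ ~ splits [set n | parity Z n] R].

(* Between consecutive free points [d k] there are [r k <= x k < r' k] with
   [r k], [r' k] in [R]; fixing membership of [x k] appropriately makes the
   parities at [r k] and [r' k] differ. *)
Lemma not_split_v0 (R : set nat) : infinite_set R -> v0 (not_split R).
Proof.
move=> /infinite_natP Rinf; apply: nowhere_dense_v0 => [Z []//|].
move=> [E X] /= /infinite_natP Einf.
have step n : exists t : (nat * nat) * (nat * nat),
    [/\ n <= t.1.1 < t.1.2, t.1.2 <= t.2.1 < t.2.2, E t.1.1, E t.2.1 &
        R t.1.2 /\ R t.2.2].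
  have [d nd Ed] := Einf n; have [r dr Rr] := Rinf d.+1.
  have [x rx Ex] := Einf r; have [r' xr' Rr'] := Rinf x.+1.
  by exists ((d, r), (x, r')); split=> //=; lia.
have [t tP] := choice step.
(* The blocks from [N k] to [N k.+1] are disjoint, each containing its own [d k], [r k], [x k] and
   [r' k]. *)
pose N := fix N k := if k is k'.+1 then (t (N k')).2.2.+1 else 0.
pose d k := (t (N k)).1.1; pose r k := (t (N k)).1.2.
pose x k := (t (N k)).2.1; pose r' k := (t (N k)).2.2.
have dP k : N k <= d k < r k by have [] := tP (N k).
have xP k : r k <= x k < r' k by have [] := tP (N k).
have Ed k : E (d k) by have [] := tP (N k).
have Ex k : E (x k) by have [] := tP (N k).
have [Rr Rr'] : (forall k, R (r k)) /\ (forall k, R (r' k)).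
  by split=> k; have [_ _ _ _ []] := tP (N k).
have NS k : N k.+1 = (r' k).+1 by [].
have Ninc k : N k < N k.+1 by have := dP k; have := xP k; rewrite NS; lia.
have Nle := homo_incr Ninc.
have uniq i j n : N i <= n < N i.+1 -> N j <= n < N j.+1 -> i = j.
  move=> ni nj; have [ij|ji|//] := ltngtP i j.
    by have := Nle _ _ ij; lia.
  by have := Nle _ _ ji; lia.
(* [F] collects the [x k] at which [X] gives equal parities; exactly these are flipped in [X']. *)
pose F n := exists2 k, n = x k & parity X (r k) = parity X (r' k).
pose X' n := (X n /\ ~ F n) \/ (~ X n /\ F n).
have Fx k n : r k <= n < r' k -> F n -> n = x k.
  move=> nk [j nj _]; rewrite nj; congr x; apply: (@uniq _ _ n).
    by have := xP j; have := dP j; rewrite NS nj; lia.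
  by have := dP k; rewrite NS; lia.
have X'par k : parity X' (r k) (+) parity X' (r' k).
  have xk := xP k; have := boolP (parity X (r k) == parity X (r' k)); case.
    move=> /eqP Xpar; rewrite (@parity_flip X' X _ (x k)) ?Xpar ?addbb //.
      move=> n nk nx; have nF : ~ F n by move=> /(Fx _ _ nk).
      by rewrite /X'; tauto.
    have Fk : F (x k) by exists k.
    by rewrite /X'; case: (pselect (X (x k))) => ?; tauto.
  move=> /eqP Xpar; have agree n : r k <= n < r' k -> (X' n <-> X n).
    move=> nk; have nF : ~ F n.
      move=> Fn; have nx := Fx _ _ nk Fn; case: Fn => j nj Xj; apply: Xpar.
      suff <- : j = k by [].
      apply: (@uniq _ _ n); last by have := dP k; rewrite NS; lia.
      by have := xP j; have := dP j; rewrite NS nj; lia.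
    by rewrite /X'; tauto.
  have rr' : r k <= r' k by lia.
  rewrite (parity_agree rr' agree).
  by move: Xpar; case: (parity X (r k)) (parity X (r' k)) => [] [].
exists (range d, X'); split.
- apply/infinite_natP => m; exists (d m); last by exists m.
  by have := le_incr Ninc m; have := dP m; lia.
- split; first by apply: subset_almost => _ [k _ <-].
  exists 0 => n _ /= nE; have nF : ~ F n by move=> [k nk]; rewrite nk in nE.
  by rewrite /X'; tauto.
- move=> Z [a Za] [_]; apply.
  (* No free point lies between [r k] and [r' k], so [Z] inherits the parity difference of [X']
     there. *)
  have Zpar k : a <= k -> parity Z (r k) (+) parity Z (r' k).
    move=> ak; have xk := xP k; have dk := dP k.
    have rr' : r k <= r' k by lia.
    rewrite (parity_agree rr' (Z' := X')) // => n nk.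
    apply: Za; first by have := le_incr Ninc k; lia.
    move=> [j _ jn]; suff jk : j = k by rewrite -jn jk in nk; lia.
    apply: (@uniq _ _ n); last by rewrite NS; lia.
    by have := xP j; have := dP j; rewrite NS -jn; lia.
  have big m k : m + a <= k -> m <= r k /\ m <= r' k.
    by have := le_incr Ninc k; have := dP k; have := xP k; lia.
  (* Each late block supplies one point of [R] of either parity. *)
  split; apply/infinite_natP => m; have [mr mr'] := big m _ (leqnn _);
    have := Zpar (m + a) (leq_addl _ _);
    case E1: (parity Z (r (m + a))); case E2: (parity Z (r' (m + a))) => // _.
  + by exists (r (m + a)).
  + by exists (r' (m + a)).
  + by exists (r' (m + a)) => //; split=> //=; rewrite E2.
  + by exists (r (m + a)) => //; split=> //=; rewrite E1.
Qed.

Lemma infinite_sets_reaping : is_reaping infinite_sets.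
Proof.
split=> // -[X Xsplits]; have [Xfin|Xinf] := pselect (finite_set X).
  have [] := Xsplits setT infinite_nat.
  by rewrite setTI.
by have [_] := Xsplits X Xinf; rewrite setDv; apply; exact: finite_set0.
Qed.

(** For each [Z], a reaping family has a member not split by the parity set of [Z]; hence the sets
    [not_split R] cover. *)
Lemma cov_v0_le_reaping : ord_le cov_v0 reaping_number.
Proof.
have : exists2 RR, is_reaping RR & cardinal_of infinite_sets = cardinal_of RR.
  by exists infinite_sets => //; exact: infinite_sets_reaping.
move=> /(least_ordP (P := fun K => exists2 RR, is_reaping RR & K = cardinal_of RR)).
rewrite -/reaping_number => -[[RR [RRinf RRreap] ->] _].
have [f [fRR _ fsurj]] := cardinal_of_bij RR.
apply: (@cov_v0_le _ (not_split \o f)) => [w|Z Zinf].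
  by apply: not_split_v0; exact/RRinf/fRR.
apply: contrapT => /forallNP nf; apply: RRreap; exists [set n | parity Z n] => R.
move=> /fsurj[w <-]; apply: contrapT => nsplit.
by apply: (nf w); split.
Qed.

(** * Comparison of add(v^0) and cov(v^0) *)

Lemma infinite_sets_not_v0 : ~ v0 infinite_sets.
Proof.
move=> [_ /(_ set0 setT)]; case.
  by split=> //; rewrite setD0; exact: infinite_nat.
move=> C [D [[CD CDinf] _ CDS]].
have Dinf : infinite_sets D.
  by apply: sub_infinite_set CDinf => n [].
suff : (segment C D `&` infinite_sets) D by rewrite CDS.
by split; [split; [exact: Dinf|split]|exact: Dinf].
Qed.

Lemma bigcup_v0 : \bigcup_(S in v0) S = infinite_sets.
Proof.
apply/seteqP; split=> Z; first by move=> [S [Sinf _] /Sinf].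
move=> Zinf; exists [set Z] => //; apply: nowhere_dense_v0; last exact: nowhere_dense1.
by move=> _ ->.
Qed.

Lemma add_v0_le_cov : ord_le add_v0 cov_v0.
Proof.
pose Pcov K := exists F : set (set (set nat)),
  [/\ F `<=` v0, \bigcup_(S in F) S = infinite_sets & K = cardinal_of F].
have [[F [Fv0 Fcov covE]] _] : is_least_ord Pcov cov_v0.
  apply: (@least_ordP _ (cardinal_of v0)); exists v0; split=> //.
  exact: bigcup_v0.
have Padd : exists F : set (set (set nat)),
    [/\ F `<=` v0, ~ v0 (\bigcup_(S in F) S) & cov_v0 = cardinal_of F].
  by exists F; split=> //; rewrite Fcov; exact: infinite_sets_not_v0.
exact: (least_ordP Padd).2 Padd.
Qed.

(** If the additivity were smaller, a witnessing family would satisfy both hypotheses of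
    [nowhere_dense_bigcup], since failure of either one bounds the covering number by the size of
    the family. *)
Lemma cov_v0_le_add : ord_le cov_v0 tower_number -> ord_le cov_v0 add_v0.
Proof.
move=> cov_t.
pose Padd K := exists F : set (set (set nat)),
  [/\ F `<=` v0, ~ v0 (\bigcup_(S in F) S) & K = cardinal_of F].
have [[F [Fv0 Fadd ->]] _] : is_least_ord Padd add_v0.
  apply: (@least_ordP _ (cardinal_of v0)); exists v0; split=> //.
  by rewrite bigcup_v0; exact: infinite_sets_not_v0.
apply: contrapT => ncov; apply: Fadd.
have [f [fF _ fsurj]] := cardinal_of_bij F.
apply: nowhere_dense_v0 => [Z [S /Fv0[Sinf _] /Sinf]//|].
have -> : \bigcup_(S in F) S = (fun Y => exists w, f w Y).
  apply/seteqP; split=> Z [S]; last by exists (f S).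
  by move=> /fsurj[w <-]; exists w.
apply: nowhere_dense_bigcup => [M Mv0|I T Tinf Tdec|w].
- apply: contrapT => nZ; apply: ncov; apply: (@cov_v0_le _ M) => // Z Zinf.
  apply: contrapT => /forallNP nM; by apply: nZ; exists Z.
(* A decreasing sequence on [I] without pseudo-intersection is a tower of length [sub_wo I]. *)
- apply: contrapT => nE; apply: ncov; apply: ord_le_trans cov_t _.
  apply: (@ord_le_trans _ (sub_wo I)); last exact: ord_le_mono (@sub_wo_mono _ I).
  have Ptow : exists T : sub_wo I -> set nat, is_tower T.
    exists (fun u => T (sval u)); split=> [u|u v uv|[E Einf ET]].
    + exact/Tinf/svalP.
    + by apply: Tdec; [exact: svalP|exact: svalP|exact: sub_wo_mono].
    + by apply: nE; exists E => // u Iu; exact: (ET (exist _ u Iu)).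
  exact: (least_ordP Ptow).2 Ptow.
- exact/v0_nowhere_dense/Fv0.
Qed.

Theorem mainTheorem1 :
  ord_eq tower_number (ord_min (cofinality continuum) reaping_number) ->
  ord_eq cov_v0 add_v0.
Proof.
move=> /ord_eq_ge min_t; apply: ord_le_anti add_v0_le_cov.
apply: cov_v0_le_add; apply: ord_le_trans min_t.
have [->|->] := ord_min_cases (cofinality continuum) reaping_number.
- exact: cov_v0_le_cofinality.
- exact: cov_v0_le_reaping.
Qed.
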